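(* Let $\boldsymbol\varepsilon$ be an $m$-dimensional random vector with $\mathrm E\,\boldsymbol\varepsilon=\mathbf 0$, and let $\mathbf v=\frac1{\sqrt m}\mathbf 1_m$, where $\mathbf 1_m$ is the $m$-vector of ones. (i) If $m=2$, then $H_0(\mathbf v)$ holds if and only if $\boldsymbol\varepsilon$ is exchangeable. (ii) Let $\boldsymbol\varepsilon$ have an elliptical distribution with a positive definite scatter matrix $\boldsymbol\Omega$. If $\boldsymbol\varepsilon$ is exchangeable, then $H_0(\mathbf v)$ holds. Moreover, $H_0(\mathbf u)$ is satisfied for any unit vector $\mathbf u\in\mathbb R^m$ orthogonal to $\mathbf v$, i.e. for any unit $\mathbf u$ such that $\mathbf u^\top\mathbf 1_m=0$.
   Context: $m\ge2$ is an integer and $\mathcal L(\boldsymbol Z)$ denotes the distribution of $\boldsymbol Z$. For a unit vector $\mathbf w\in\mathbb R^m$, $H_0(\mathbf w)$ is the statement $\mathcal L(\boldsymbol\varepsilon)=\mathcal L(\mathbf R_{\mathbf w}\boldsymbol\varepsilon)$, where $\mathbf R_{\mathbf w}=2\mathbf w\mathbf w^\top-\mathbf I$. A random vector $\boldsymbol Z$ is exchangeable if $\mathcal L(\boldsymbol Z)=\mathcal L(\mathbf P\boldsymbol Z)$ for every permutation matrix $\mathbf P$. A random vector $\boldsymbol Z$ is spherically symmetric around $\mathbf 0$ if $\mathcal L(\boldsymbol Z)=\mathcal L(\mathbf A\boldsymbol Z)$ for every orthogonal matrix $\mathbf A$. A random vector $\boldsymbol W$ has an elliptical distribution with location $\boldsymbol\mu$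 and positive semidefinite scatter matrix $\boldsymbol\Omega$ if $\boldsymbol W=\boldsymbol\mu+\boldsymbol\Omega^{1/2}\boldsymbol Z$ for some $\boldsymbol Z$ spherically symmetric around $\mathbf 0$. *)

(* Defs.v *)
From HB Require Import structures.
From mathcomp Require Import all_boot all_order all_algebra.
From mathcomp Require Import all_classical all_reals all_analysis.

Set Implicit Arguments.
Unset Strict Implicit.
Unset Printing Implicit Defensive.

Import Order.TTheory GRing.Theory Num.Theory.
Import numFieldNormedType.Exports.

Local Open Scope classical_set_scope.
Local Open Scope ring_scope.

(* R^m, as column vectors, with the Borel sigma-algebra of its topology. *)
Notation borel_cV R m := (g_sigma_algebraType (@open 'cV[R]_m)).

Lemma mulmx_continuous (R : realType) (m n : nat) (A : 'M[R]_(n, m)) :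
  continuous (mulmx A : 'cV[R]_m -> 'cV[R]_n).
Proof.
move=> x U [V nV sVU].
have coef i j : \forall y \near x, V i j ((A *m y) i j).
  have cij : continuous (fun y : 'cV[R]_m => \sum_k A i k * y k j).
    apply: continuous_big => [|k _ y]; first exact: add_continuous.
    apply: (@cvgM _ _ (nbhs y) _ _ _ _ _ (cvg_cst (A i k)));
      exact: (@coord_continuous R m 1 k j y).
  have := nV i j; rewrite mxE => /(cij x); rewrite nbhs_filterE.
  by apply: (@filterS _ (nbhs x)) => y /=; rewrite mxE.
apply: (@filterS _ (nbhs x) _ [set y | forall i j, V i j ((A *m y) i j)]).
  by move=> y Vy; apply: sVU.
apply: (@filter_forall _ _ _ (nbhs x)) => i.
by apply: (@filter_forall _ _ _ (nbhs x)) => j; exact: coef.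
Qed.

Lemma measurable_mulmx (R : realType) (m n : nat) (A : 'M[R]_(n, m)) :
  measurable_fun [set: borel_cV R m] (mulmx A : borel_cV R m -> borel_cV R n).
Proof.
apply: (@measurability _ _ (borel_cV R m) (borel_cV R n) setT (mulmx A) (@open 'cV[R]_n)) => //.
move=> _ [B oB <-]; rewrite setTI; apply: sub_sigma_algebra.
by move/continuousP: (@mulmx_continuous R m n A); exact.
Qed.

Section RandomVectors.
Context {R : realType} {d : measure_display} {T : measurableType d}.
Variable P : probability T R.

Section LinearImage.
Variables (m n : nat) (A : 'M[R]_(n, m)) (X : {RV P >-> borel_cV R m}).

Definition mulRV : T -> borel_cV R n := fun t => A *m (X t : 'cV[R]_m).

Lemma measurable_mulRV : measurable_fun [set: T] mulRV.
Proof. exact: (measurableT_comp (@measurable_mulmx R m n A)). Qed.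

HB.instance Definition _ :=
  isMeasurableFun.Build _ _ T (borel_cV R n) mulRV measurable_mulRV.

End LinearImage.

Context {m : nat}.
Implicit Types X Y : {RV P >-> borel_cV R m}.

(* The restriction to Borel sets matters: as a function on all subsets of R^m,
   a [distribution] carries irrelevant values on non-measurable sets. *)
Definition eq_law X Y : Prop :=
  forall B : set (borel_cV R m), measurable B ->
    distribution P X B = distribution P Y B.

Definition coordRV X (i : 'I_m) : T -> R := fun t => (X t : 'cV[R]_m) i 0.

(* Integrability is required because ['E_P[_]] is total: a vanishing value
   does not imply by itself that the expectation exists. *)
Definition has_mean X (mu : 'cV[R]_m) : Prop :=
  forall i : 'I_m,
    P.-integrable [set: T] (EFin \o coordRV X i) /\
    'E_P[coordRV X i]%E = (mu i 0)%:E.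

Definition exchangeable X : Prop :=
  forall A : 'M[R]_m, is_perm_mx A -> eq_law X (mulRV A X).

Definition spherical X : Prop :=
  forall A : 'M[R]_m, A^T *m A = 1%:M -> eq_law X (mulRV A X).

Definition psdmx (S : 'M[R]_m) : Prop :=
  S \is symmetricmx /\ forall x : 'cV[R]_m, 0 <= (x^T *m S *m x) 0 0.

Definition posdefmx (S : 'M[R]_m) : Prop :=
  S \is symmetricmx /\
  forall x : 'cV[R]_m, x != 0 -> 0 < (x^T *m S *m x) 0 0.

(* [S] is the (unique) positive semidefinite square root of [Omega]. *)
Definition is_sqrtmx (Omega S : 'M[R]_m) : Prop :=
  psdmx S /\ S *m S = Omega.

Definition elliptical X (mu : 'cV[R]_m) (Omega : 'M[R]_m) : Prop :=
  psdmx Omega /\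
  exists (S : 'M[R]_m) (Z : {RV P >-> borel_cV R m}),
    [/\ is_sqrtmx Omega S, spherical Z
      & forall t, X t = mu + S *m (Z t : 'cV[R]_m) :> 'cV[R]_m].

(* Euclidean norm 1; the norm [`|w|] of the library is the sup norm. *)
Definition unit_vec (w : 'cV[R]_m) : Prop := w^T *m w = 1%:M.

Definition reflmx (w : 'cV[R]_m) : 'M[R]_m := 2%:R *: (w *m w^T) - 1%:M.

Definition H0 X (w : 'cV[R]_m) : Prop := eq_law X (mulRV (reflmx w) X).

End RandomVectors.

Definition ones (R : realType) (m : nat) : 'cV[R]_m := const_mx 1.

Definition vdir (R : realType) (m : nat) : 'cV[R]_m :=
  (Num.sqrt m%:R)^-1 *: ones R m.

(* Main.v *)
(* A spherical vector Z has b^T Z distributed as |b| Z_1, so that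
   E|b^T Z| = |b| E|Z_1|.  Once Z is integrable, the first absolute moments of
   the linear forms in A Z therefore determine A A^T, unless Z = 0 almost
   surely; no second moment is needed.  Hence, if eps = S Z is exchangeable,
   Omega = S^2 is invariant under conjugation by permutation matrices, i.e.
   Omega = p I + q 1 1^T.  If w is parallel or orthogonal to 1, then R_w
   commutes with Omega, so Q = S^-1 R_w S is orthogonal and
   R_w eps = S Q Z has the law of S Z = eps.  The location vanishes because
   Z and -Z have the same law. *)
Require Import Defs.
From mathcomp Require Import all_boot all_order all_algebra all_fingroup.
From mathcomp Require Import all_classical all_reals all_analysis.
From mathcomp Require Import measurable_realfun ring lra.

Import Order.TTheory GRing.Theory Num.Theory.
Import numFieldNormedType.Exports.
Local Open Scope classical_set_scope.
Local Open Scope ring_scope.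

(** * Euclidean inner product, orthogonal maps and quadratic forms *)

Definition dotv {R : realType} {m : nat} (a b : 'cV[R]_m) : R := (a^T *m b) 0 0.

Section Dot.
Context {R : realType} {m : nat}.
Implicit Types (a b c x y : 'cV[R]_m) (A B : 'M[R]_m).

Lemma dotvE a b : dotv a b = \sum_i a i 0 * b i 0.
Proof. by rewrite /dotv mxE; apply: eq_bigr => i _; rewrite mxE. Qed.

Lemma dotvC a b : dotv a b = dotv b a.
Proof. by rewrite !dotvE; apply: eq_bigr => i _; rewrite mulrC. Qed.

Lemma dotvDr a b c : dotv a (b + c) = dotv a b + dotv a c.
Proof. by rewrite /dotv mulmxDr mxE. Qed.

Lemma dotvDl a b c : dotv (a + b) c = dotv a c + dotv b c.
Proof. by rewrite !(dotvC _ c) dotvDr. Qed.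

Lemma dotvZr k a b : dotv a (k *: b) = k * dotv a b.
Proof. by rewrite /dotv -scalemxAr mxE. Qed.

Lemma dotvZl k a b : dotv (k *: a) b = k * dotv a b.
Proof. by rewrite dotvC dotvZr dotvC. Qed.

Lemma dotv_mulmx A a b : dotv a (A *m b) = dotv (A^T *m a) b.
Proof. by rewrite /dotv trmx_mul trmxK mulmxA. Qed.

Lemma dotv_delta i b : dotv (delta_mx i 0) b = b i 0.
Proof. by rewrite /dotv trmx_delta -rowE mxE. Qed.

Lemma dotv_ge0 a : 0 <= dotv a a.
Proof. by rewrite dotvE sumr_ge0 // => i _; rewrite -expr2 sqr_ge0. Qed.

Lemma dotv_eq0 a : (dotv a a == 0) = (a == 0).
Proof.
apply/idP/eqP => [|->]; last by rewrite /dotv mulmx0 mxE.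
rewrite dotvE psumr_eq0 => [/allP a0|i _]; last by rewrite -expr2 sqr_ge0.
apply/colP => i; rewrite mxE; apply/eqP.
by have := a0 i (mem_index_enum _); rewrite /= mulf_eq0 orbb.
Qed.

Lemma dotv_outer a b x : (a *m b^T) *m x = dotv b x *: a.
Proof.
by rewrite -mulmxA [b^T *m x]mx11_scalar mul_mx_scalar.
Qed.

(* The Householder reflection along [b - c] exchanges [b] and [c]. *)
Lemma orthogonal_transitive b c : dotv b b = dotv c c ->
  exists2 A, A^T *m A = 1%:M & A *m b = c.
Proof.
move=> bc; have [<-|neq] := eqVneq b c.
  by exists 1%:M; rewrite ?trmx1 ?mul1mx.
have [w wE] : exists w, w = b - c by exists (b - c).
pose k := 2 / dotv w w.
have w0 : dotv w w != 0 by rewrite wE dotv_eq0 subr_eq0.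
have kw : k * dotv w w = 2 by rewrite /k divfK.
pose A : 'M[R]_m := 1%:M - k *: (w *m w^T).
have At : A^T = A by rewrite /A linearB linearZ /= trmx1 trmx_mul trmxK.
have ww : (w *m w^T) *m (w *m w^T) = dotv w w *: (w *m w^T).
  by rewrite mulmxA dotv_outer -scalemxAl.
exists A.
  rewrite At /A mulmxBr mulmx1 mulmxBl mul1mx -scalemxAl -scalemxAr ww.
  rewrite !scalerA -[_ * dotv w w]mulrA kw.
  by apply/matrixP => i j; rewrite !mxE; ring.
rewrite /A mulmxBl mul1mx -scalemxAl dotv_outer scalerA.
(* As [b] and [c] have equal length, |b - c|^2 = 2 (b.b - b.c) = 2 w.b. Hence [k] times w.b is 1,
   and [A] sends [b] to b - w = c. *)
have -> : dotv w b = dotv w w / 2.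
  have dwE : dotv w = fun x => dotv b x - dotv c x.
    by apply/funext => x; rewrite wE dotvDl -scaleN1r dotvZl mulN1r.
  have xw x : dotv x w = dotv x b - dotv x c.
    by rewrite wE dotvDr -scaleN1r dotvZr mulN1r.
  by rewrite dwE !xw (dotvC c b) bc; field.
by rewrite mulrA kw divff // scale1r wE opprB addrC subrK.
Qed.

Lemma sym_trmx A : A \is symmetricmx -> A^T = A.
Proof.
by move=> /is_hermitianmxP; rewrite expr0 scale1r map_mx_id // => {2}->.
Qed.

Lemma sym_dotv A a b : A^T = A -> dotv a (A *m b) = dotv (A *m a) b.
Proof. by move=> At; rewrite dotv_mulmx At. Qed.

Lemma posdefmx_unit A : posdefmx A -> A \in unitmx.
Proof.
move=> [_ Apos]; rewrite unitmxE unitfE; apply/negP => /det0P[v v0 vA].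
have vt0 : v^T != 0 by rewrite trmx_eq0.
by have := Apos _ vt0; rewrite trmxK vA mul0mx mxE ltxx.
Qed.

(** Polarization: the form at e_i + e_j, minus its values at e_i and e_j, is twice the (i, j)
    entry. *)
Lemma sym_quad_inj A B : A^T = A -> B^T = B ->
  (forall a, dotv a (A *m a) = dotv a (B *m a)) -> A = B.
Proof.
move=> At Bt AB; apply/matrixP => i j.
have polar C : C^T = C -> forall a b,
    dotv (a + b) (C *m (a + b)) =
      dotv a (C *m a) + dotv b (C *m b) + 2 * dotv a (C *m b).
  move=> Ct a b; rewrite mulmxDr !dotvDl !dotvDr (sym_dotv C b) //.
  by rewrite (dotvC (C *m b)); ring.
have entry C : dotv (delta_mx i 0) (C *m (delta_mx j 0 : 'cV[R]_m)) = C i j.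
  by rewrite dotv_delta -colE mxE.
have := AB (delta_mx i 0 + delta_mx j 0).
by rewrite !polar // !AB !entry => /addrI /(mulfI _)->.
Qed.

(** * Permutation-invariant matrices and the reflections commuting with them *)

Lemma perm_mx_conjE (s : 'S_m) A i j :
  (perm_mx s *m A *m (perm_mx s)^T) i j = A (s i) (s j).
Proof. by rewrite tr_perm_mx -col_permE -row_permE !mxE. Qed.

(** Transpositions move any diagonal position to any other and, with symmetry, any off-diagonal
    position to any other. So [A] has one value on the diagonal and one, [q], off it; [p] is their
    difference. The bound on [m] provides the position (0, 1) from which [q] is read. *)
Lemma perm_invariant_mx A : (1 < m)%N -> A^T = A ->
  (forall s : 'S_m, perm_mx s *m A *m (perm_mx s)^T = A) ->
  exists p q : R, A = p%:M + q *: (ones R m *m (ones R m)^T).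
Proof.
move=> m1 At Ainv; pose i0 := Ordinal (ltnW m1); pose j0 := Ordinal m1.
have As (s : 'S_m) i j : A (s i) (s j) = A i j.
  by rewrite -[in RHS](Ainv s) perm_mx_conjE.
have Asym i j : A i j = A j i by rewrite -[in LHS]At mxE.
have diag i j : A i i = A j j by rewrite -(As (tperm i j) i i) tpermL.
have off1 i j k : i != j -> k != j -> A i j = A k j.
  by move=> ij kj; rewrite -(As (tperm i k) i j) tpermL tpermD // eq_sym.
have off i j k l : i != j -> k != l -> A i j = A k l.
  move=> ij kl; have [lj|lj] := eqVneq l j; first by subst l; exact: off1.
  (* One index is changed at a time. When [k = j], passing through [A k j] would land on the
     diagonal, so the path goes through [A l j]. *)
  have [kj|kj] := eqVneq k j.
    by subst k; rewrite (off1 _ _ l) // Asym.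
  by rewrite (off1 _ _ k) // Asym (off1 _ _ l) 1?eq_sym // Asym.
exists (A i0 i0 - A i0 j0), (A i0 j0); apply/matrixP => i j.
rewrite !mxE big_ord1 !mxE mulr1 mulr1; have [<-|ij] := eqVneq i j.
  by rewrite mulr1n subrK.
by rewrite mulr0n add0r; exact: off.
Qed.

Lemma reflmx_tr x : (reflmx x)^T = reflmx x.
Proof. by rewrite /reflmx linearB linearZ /= trmx1 trmx_mul trmxK. Qed.

Lemma reflmx_invol x : unit_vec x -> reflmx x *m reflmx x = 1%:M.
Proof.
move=> xx; rewrite /reflmx mulmxBr mulmx1 mulmxBl mul1mx -scalemxAr -scalemxAl.
rewrite mulmxA -(mulmxA x) xx mulmx1.
by apply/matrixP => i j; rewrite !mxE; ring.
Qed.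

(** It is enough that x x^T commutes with J = 1 1^T: if x is orthogonal to 1 both products vanish,
    and if x = k 1 then x x^T is a multiple of J. *)
Lemma reflmx_comm x p q :
    x^T *m ones R m = 0 \/ (exists k, x = k *: ones R m) ->
  let A := p%:M + q *: (ones R m *m (ones R m)^T) in
  reflmx x *m A = A *m reflmx x.
Proof.
move=> hx A; rewrite /reflmx mulmxBl mulmxBr mul1mx mulmx1; congr (_ - _).
rewrite -scalemxAl -scalemxAr; congr (_ *: _).
rewrite /A mulmxDl mulmxDr scalar_mxC; congr (_ + _).
rewrite -scalemxAl -scalemxAr; congr (_ *: _).
case: hx => [xo|[k ->]].
  have ox : (ones R m)^T *m x = 0 by rewrite -[x]trmxK -trmx_mul xo trmx0.
  rewrite -mulmxA (mulmxA x^T) xo mul0mx mulmx0.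
  by rewrite -mulmxA (mulmxA _ x) ox mul0mx mulmx0.
rewrite [(k *: _)^T]linearZ /= -(scalemxAl k) -(scalemxAr k).
by rewrite -!scalemxAl -!scalemxAr.
Qed.

Lemma vdir_unit : (0 < m)%N -> unit_vec (vdir R m).
Proof.
move=> m0; rewrite /unit_vec /vdir [(_ *: _)^T]linearZ /= -scalemxAl -scalemxAr scalerA.
have -> : (ones R m)^T *m ones R m = m%:R%:M.
  apply/matrixP => i j; rewrite !mxE !ord1 mulr1n.
  rewrite (eq_bigr (fun=> 1)) ?sumr_const ?card_ord //.
  by move=> l _; rewrite !mxE mulr1.
rewrite scale_scalar_mx -invfM -expr2 sqr_sqrtr ?ler0n // mulVf //.
by rewrite pnatr_eq0 -lt0n.
Qed.

End Dot.

(** * Dimension two *)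

Lemma ord2P (i : 'I_2) : i = 0 \/ i = 1.
Proof. by case: i => [[|[|]]] // h; [left|right]; apply: val_inj. Qed.

(** In the plane 2 v v^T is the all-ones matrix; removing the identity leaves the swap of
    coordinates. *)
Lemma reflmx_vdir2 (R : realType) :
  reflmx (vdir R 2) = perm_mx (tperm 0 1).
Proof.
apply/matrixP => i j.
have s2 : (Num.sqrt (2 : R))^-1 * (Num.sqrt 2)^-1 = 2^-1.
  by rewrite -invfM -expr2 sqr_sqrtr.
rewrite !mxE big_ord1 !mxE !mulr1 s2 divff //.
case: (ord2P i) => ->; rewrite ?tpermL ?tpermR;
  by case: (ord2P j) => ->; rewrite ?subrr ?subr0.
Qed.

Lemma perm_mx2 (R : realType) (A : 'M[R]_2) :
  is_perm_mx A -> A = 1%:M \/ A = perm_mx (tperm 0 1).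
Proof.
case/is_perm_mxP => s ->.
have s01 : s 0 != s 1 by rewrite (inj_eq perm_inj).
case: (ord2P (s 0)) (ord2P (s 1)) s01 => s0 [] s1; rewrite s0 s1 // => _;
  [left; rewrite -perm_mx1|right]; congr perm_mx; apply/permP => i;
  by case: (ord2P i) => ->; rewrite ?perm1 ?tpermL ?tpermR.
Qed.

(** * Borel measurability of linear forms *)

Lemma measurable_coord (R : realType) (m : nat) (i : 'I_m) :
  measurable_fun [set: borel_cV R m] (fun y : borel_cV R m => (y : 'cV[R]_m) i 0).
Proof.
apply: (measurability _ (measurable_realfun.RGenOpens.measurableE R)) => //.
move=> _ [_ [a [b ->]] <-]; rewrite setTI; apply: sub_sigma_algebra.
have /continuousP := @coord_continuous R m 1 i 0.
by apply; exact: interval_open.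
Qed.

Lemma measurable_dotv (R : realType) (m : nat) (b : 'cV[R]_m) :
  measurable_fun [set: borel_cV R m] (dotv b : borel_cV R m -> R).
Proof.
exact: (measurableT_comp (@measurable_coord R 1 0) (@measurable_mulmx R m 1 b^T)).
Qed.

(** * Equality in law and first absolute moments of linear forms *)

Section Laws.
Context {R : realType} {d : measure_display} {T : measurableType d}.
Context {P : probability T R} {m : nat}.
Implicit Types (X Y Z : {RV P >-> borel_cV R m}) (b c : 'cV[R]_m).

Lemma eq_law_sym X Y : eq_law X Y -> eq_law Y X.
Proof. by move=> XY B mB; rewrite XY. Qed.

Lemma eq_law_trans X Y Z : eq_law X Y -> eq_law Y Z -> eq_law X Z.
Proof. by move=> XY YZ B mB; rewrite XY// YZ. Qed.

Lemma eq_law_fun X Y : (forall t, X t = Y t) -> eq_law X Y.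
Proof.
move=> XY B mB; rewrite /distribution /= /pushforward.
by have -> : (X : T -> _) = Y by apply/funext.
Qed.

Lemma eq_law_mulRV (A : 'M[R]_m) X Y : eq_law X Y ->
  eq_law (P := P) (mulRV A X) (mulRV A Y).
Proof.
move=> XY B mB; apply: (XY (mulmx A @^-1` B)).
by rewrite -[X in measurable X]setTI; exact: measurable_mulmx.
Qed.

Lemma eq_law_integral X Y (f : borel_cV R m -> \bar R) : eq_law X Y ->
  measurable_fun [set: borel_cV R m] f ->
  P.-integrable setT (f \o X) -> P.-integrable setT (f \o Y) ->
  (\int[P]_t f (X t) = \int[P]_t f (Y t))%E.
Proof.
move=> XY mf iX iY.
rewrite -(integral_distribution mf iX) -(integral_distribution mf iY).
by apply: eq_measure_integral => B mB _; exact: XY.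
Qed.

(** Valued in the extended reals: the integrand is nonnegative, so moments can be compared before
    they are known to be finite. *)
Definition abs_moment X b : \bar R := (\int[P]_t `|dotv b (X t)|%:E)%E.

Lemma measurable_dotRV X b : measurable_fun [set: T] (fun t => dotv b (X t)).
Proof. exact: (measurableT_comp (@measurable_dotv R m b)). Qed.

Lemma eq_law_abs_moment X Y b : eq_law X Y -> abs_moment X b = abs_moment Y b.
Proof.
move=> XY; pose f (y : borel_cV R m) := `|dotv b (y : 'cV[R]_m)|%:E.
have mf : measurable_fun [set: borel_cV R m] f.
  apply/measurable_EFinP; apply: measurableT_comp => //.
  exact: measurable_dotv.
have f0 y : (0 <= f y)%E by rewrite lee_fin.
rewrite /abs_moment -[LHS](ge0_integral_distribution X mf f0).
rewrite -[RHS](ge0_integral_distribution Y mf f0).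
by apply: eq_measure_integral => B mB _; exact: XY.
Qed.

Lemma abs_moment_mulRV (A : 'M[R]_m) X b :
  abs_moment (mulRV A X) b = abs_moment X (A^T *m b).
Proof. by apply: eq_integral => t _; rewrite /mulRV dotv_mulmx. Qed.

Lemma abs_momentZ X k b : (abs_moment X (k *: b) = `|k|%:E * abs_moment X b)%E.
Proof.
have mb : measurable_fun setT (fun t => `|dotv b (X t)|%:E).
  by apply/measurable_EFinP; apply: measurableT_comp => //; exact: measurable_dotRV.
rewrite /abs_moment -ge0_integralZl// ?lee_fin//.
by apply: eq_integral => t _; rewrite dotvZl normrM EFinM.
Qed.

Lemma spherical_abs_moment Z b c : spherical Z -> dotv b b = dotv c c ->
  abs_moment Z b = abs_moment Z c.
Proof.
move=> sZ bc; have [A AtA Abc] := orthogonal_transitive _ _ bc.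
(* The moment of A^T Z along [b] is that of Z along A b = c, so sphericity is applied to the
   transpose. *)
have AAt : (A^T)^T *m A^T = 1%:M by rewrite trmxK; exact: mulmx1C.
by rewrite (eq_law_abs_moment _ _ _ (sZ _ AAt)) abs_moment_mulRV trmxK Abc.
Qed.

(** The vectors [b] and |b| e have the same length, and the moment is homogeneous. *)
Lemma spherical_abs_momentE Z b e : spherical Z -> dotv e e = 1 ->
  (abs_moment Z b = (Num.sqrt (dotv b b))%:E * abs_moment Z e)%E.
Proof.
move=> sZ e1; rewrite -[Num.sqrt _]ger0_norm ?sqrtr_ge0// -abs_momentZ.
apply: spherical_abs_moment => //.
by rewrite dotvZl dotvZr e1 mulr1 -expr2 sqr_sqrtr// dotv_ge0.
Qed.

(** * Means of affine images and of spherical vectors *)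

Lemma has_mean_affine (A : 'M[R]_m) X Y mu nu : has_mean X mu ->
    (forall t, Y t = A *m (X t - nu : 'cV[R]_m) :> 'cV[R]_m) ->
  has_mean Y (A *m (mu - nu)).
Proof.
move=> hX XY i.
have iX j : P.-integrable setT (EFin \o coordRV X j) by case: (hX j).
have inu j : P.-integrable setT (cst (nu j 0)%:E : T -> \bar R).
  exact: (finite_measure_integrable_cst P (nu j 0)).
have iXnu j : P.-integrable setT (fun t => (coordRV X j t)%:E - (nu j 0)%:E)%E.
  exact: (integrableB _ (iX j) (inu j)).
have YE : EFin \o coordRV Y i =
    (fun t => \sum_j (A i j)%:E * ((coordRV X j t)%:E - (nu j 0)%:E))%E.
  apply/funext => t /=; rewrite /coordRV XY mxE -sumEFin.
  by apply: eq_bigr => j _; rewrite !mxE.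
split; first by rewrite YE; apply: integrable_sum => // j _; exact: integrableZl.
rewrite unlock.
change (\int[P]_t (EFin \o coordRV Y i) t = ((A *m (mu - nu)) i 0)%:E)%E.
rewrite YE integral_sum// => [|j]; last exact: integrableZl.
rewrite mxE -sumEFin; apply: eq_bigr => j _.
rewrite integralZl// (integralB _ (iX j) (inu j))//.
have [_] := hX j; rewrite unlock => /= ->.
rewrite integral_cst// (_ : _ [set: T] = 1%E); last exact: probability_setT.
by rewrite mule1 !mxE.
Qed.

Lemma spherical_mean0 Z nu : spherical Z -> has_mean Z nu -> nu = 0.
Proof.
move=> sZ hZ; apply/colP => i; rewrite mxE.
have N1 : (- 1%:M)^T *m (- 1%:M) = 1%:M :> 'M[R]_m.
  by rewrite [(- _)^T]linearN /= trmx1 mulNmx mulmxN opprK mul1mx.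
have hNZ : has_mean (P := P) (mulRV (- 1%:M) Z) (- 1%:M *m (nu - 0)).
  by apply: (has_mean_affine _ _ _ _ _ hZ) => t; rewrite subr0.
have [iZ EZ] := hZ i; have [iNZ ENZ] := hNZ i.
have mf : measurable_fun setT (fun y : borel_cV R m => ((y : 'cV[R]_m) i 0)%:E).
  by apply/measurable_EFinP; exact: measurable_coord.
have := eq_law_integral _ _ _ (sZ _ N1) mf iZ iNZ.
move: EZ ENZ; rewrite unlock => EZ ENZ; rewrite [LHS]EZ [RHS]ENZ.
by rewrite subr0 mulNmx mul1mx mxE => -[]; lra.
Qed.

(** * The degenerate case and the identification of A A^T *)

Lemma ae_eq_law X Y : {ae P, forall t, X t = Y t} -> eq_law X Y.
Proof.
move=> XY B mB.
have mX W : measurable ((W : {RV P >-> borel_cV R m}) @^-1` B).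
  by rewrite -[_ @^-1` _]setTI; exact: measurable_funP.
(* Probabilities become integrals of indicators, to which almost everywhere equality applies
   directly. *)
have lawE W : distribution P W B = (\int[P]_t (\1_(W @^-1` B) t)%:E)%E.
  by rewrite integral_indic// setIT.
rewrite !lawE.
apply: ae_eq_integral => //.
- by apply/measurable_EFinP; exact: measurable_indic.
- by apply/measurable_EFinP; exact: measurable_indic.
apply: filterS XY => t XYt _.
have tE W : (t \in W @^-1` B) = (W t \in B) by apply/idP/idP; rewrite !inE.
by rewrite /= !indicE !tE XYt.
Qed.

(** Each coordinate vanishes off a null set, and there are finitely many coordinates. *)
Lemma abs_moment0_ae Z : (forall i, abs_moment Z (delta_mx i 0) = 0) ->
  {ae P, forall t, (Z t : 'cV[R]_m) = 0}.
Proof.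
move=> Z0.
have : {ae P, forall t, forall i, (Z t : 'cV[R]_m) i 0 = 0}.
  apply: filter_forall => i.
  have mZ : measurable_fun setT (fun t => (dotv (delta_mx i 0) (Z t))%:E).
    by apply/measurable_EFinP; exact: measurable_dotRV.
  have [+ _] := ae_eq_integral_abs P measurableT mZ.
  move=> /(_ (Z0 i)); apply: filterS => t /(_ I) [].
  by rewrite dotv_delta.
by apply: filterS => t Zt; apply/colP => i; rewrite mxE.
Qed.

Lemma has_mean_abs_moment_fin X mu i : has_mean X mu ->
  abs_moment X (delta_mx i 0) \is a fin_num.
Proof.
move=> /(_ i)[/integrable_abse /integrable_fin_num + _] => /(_ measurableT).
congr (_ \is a fin_num); apply: eq_integral => t _.
by rewrite dotv_delta.
Qed.

(** With k = E|Z_i0|, the moments of A Z and B Z along b are |A^T b| k and |B^T b| k. The mean makes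
    k finite, so a nonzero k cancels and the quadratic forms of A A^T and B B^T agree. If k = 0,
    every coordinate of Z has zero absolute moment. *)
Lemma spherical_scatter (i0 : 'I_m) Z (mu : 'cV[R]_m) (A B : 'M[R]_m) :
    spherical Z -> has_mean Z mu -> eq_law (P := P) (mulRV A Z) (mulRV B Z) ->
  {ae P, forall t, (Z t : 'cV[R]_m) = 0} \/ A *m A^T = B *m B^T.
Proof.
move=> sZ hZ AB; pose k := abs_moment Z (delta_mx i0 0).
have e1 i : dotv (delta_mx i 0 : 'cV[R]_m) (delta_mx i 0) = 1.
  by rewrite dotv_delta mxE !eqxx.
have kfin : k \is a fin_num := has_mean_abs_moment_fin _ _ i0 hZ.
have [k0|k0] := eqVneq k 0%E; [left|right].
  apply: abs_moment0_ae => i.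
  by rewrite (spherical_abs_momentE _ _ _ sZ (e1 i0)) [X in (_ * X)%E]k0 mule0.
apply: sym_quad_inj; rewrite ?trmx_mul ?trmxK// => b.
rewrite -!mulmxA !(dotv_mulmx _ b).
have := eq_law_abs_moment _ _ b AB.
have sE c := spherical_abs_momentE Z c _ sZ (e1 i0).
rewrite !abs_moment_mulRV (sE (A^T *m b)) (sE (B^T *m b)) -/k.
rewrite -(fineK kfin) -!EFinM => -[] /mulIf.
have fk0 : fine k != 0 by apply: contra k0 => /eqP fk0; rewrite -(fineK kfin) fk0.
by move=> /(_ fk0) /eqP; rewrite eqr_sqrt ?dotv_ge0// => /eqP.
Qed.

(** * Centred elliptical vectors and their reflections *)

Lemma spherical_mulRV_eq (A B Q : 'M[R]_m) Z : spherical Z -> Q^T *m Q = 1%:M ->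
  B = A *m Q -> eq_law (P := P) (mulRV A Z) (mulRV B Z).
Proof.
move=> sZ QQ ->; apply: eq_law_trans (eq_law_mulRV A _ _ (sZ _ QQ)) _.
by apply: eq_law_fun => t; exact: mulmxA.
Qed.

(** Since S^2 = Omega is invertible, so is S, and Z = S^-1 (X - mu) inherits integrability from X
    with mean -S^-1 mu. Sphericity makes this mean zero, hence mu = 0. *)
Lemma elliptical_centered X mu Omega : has_mean X 0 -> posdefmx Omega ->
  elliptical X mu Omega -> exists S Z,
    [/\ S^T = S, S *m S = Omega, spherical Z, has_mean Z 0
      & forall t, X t = S *m (Z t : 'cV[R]_m) :> 'cV[R]_m].
Proof.
move=> hX /posdefmx_unit Ou [_ [S [Z [[[Ssym _] SS] sZ XZ]]]].
have Su : S \in unitmx by move: Ou; rewrite -SS unitmx_mul andbb.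
have hZ : has_mean Z (invmx S *m (0 - mu)).
  apply: (has_mean_affine _ _ _ _ _ hX) => t.
  by rewrite XZ addrAC subrr add0r mulKmx.
have mu0 : mu = 0.
  have := spherical_mean0 _ _ sZ hZ => /(congr1 (mulmx S)).
  by rewrite mulKVmx// mulmx0 sub0r => /eqP; rewrite oppr_eq0 => /eqP.
rewrite mu0 subr0 mulmx0 in hZ.
exists S, Z; split => //; first exact: sym_trmx.
by move=> t; rewrite XZ mu0 add0r.
Qed.

Lemma exchangeable_elliptical_H0 X mu Omega w : (1 < m)%N -> has_mean X 0 ->
    posdefmx Omega -> elliptical X mu Omega -> exchangeable X -> unit_vec w ->
    w^T *m ones R m = 0 \/ (exists k, w = k *: ones R m) ->
  H0 X w.
Proof.
move=> m1 hX Opos ell eX w1 hw.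
have [S [Z [St SS sZ hZ XZ]]] := elliptical_centered _ _ _ hX Opos ell.
have OU : S *m S \in unitmx by rewrite SS; exact: posdefmx_unit.
have Su : S \in unitmx by move: OU; rewrite unitmx_mul andbb.
have XS : eq_law X (mulRV S Z) by exact: eq_law_fun.
have XA (A : 'M[R]_m) : eq_law (P := P) (mulRV A X) (mulRV (A *m S) Z).
  by apply: eq_law_fun => t; rewrite /= /mulRV XZ mulmxA.
apply: eq_law_trans (XS) _; apply: eq_law_trans _ (eq_law_sym _ _ (XA _)).
(* If Z = 0 almost surely, the moments say nothing about the scatter, but both sides are then almost
   surely 0. *)
have [Z0|Z0] := pselect {ae P, forall t, (Z t : 'cV[R]_m) = 0}.
  by apply: ae_eq_law; apply: filterS Z0 => t Zt; rewrite /= /mulRV Zt !mulmx0.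
(* Solves S Q = R_w S; what remains is the orthogonality of [Q]. *)
pose Q := invmx S *m reflmx w *m S.
apply: (spherical_mulRV_eq _ _ Q) => //; last by rewrite /Q !mulmxA mulmxV// mul1mx.
have rc : reflmx w *m (S *m S) = (S *m S) *m reflmx w.
  (* For a permutation matrix P, exchangeability gives P S Z the law of S Z, and comparing scatters
     yields P S^2 P^T = S^2. *)
  suff Os (s : 'S_m) : perm_mx s *m (S *m S) *m (perm_mx s)^T = S *m S.
    have Ot : (S *m S)^T = S *m S by rewrite trmx_mul St.
    have [p [q ->]] := perm_invariant_mx _ m1 Ot Os.
    exact: reflmx_comm.
  have sX : eq_law (P := P) (mulRV (perm_mx s *m S) Z) (mulRV S Z).
    apply: eq_law_trans (eq_law_sym _ _ (XA _)) _; apply: eq_law_trans _ XS.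
    by apply: eq_law_sym; apply: eX; exact: perm_mx_is_perm.
  have [//|] := spherical_scatter (Ordinal m1) _ _ _ _ sZ hZ sX.
  by rewrite trmx_mul St !mulmxA.
have rr := reflmx_invol _ w1.
have -> : Q^T = S *m reflmx w *m invmx S.
  by rewrite /Q !trmx_mul trmx_inv St reflmx_tr mulmxA.
(* This is S Q^T Q = S: the extra factor S completes S^2, past which R_w moves to the left by [rc];
   the inverses then cancel and R_w R_w = 1. *)
have Q1 : S *m (S *m reflmx w *m invmx S *m (invmx S *m reflmx w *m S)) = S.
  transitivity (S *m S *m reflmx w *m invmx S *m invmx S *m reflmx w *m S).
    by rewrite !mulmxA.
  by rewrite -rc mulmxA !mulmxK// rr mul1mx.
by rewrite -[LHS](mulKmx Su) Q1 mulVmx.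
Qed.

End Laws.

Theorem lemma6 (R : realType) (d : measure_display) (T : measurableType d)
    (P : probability T R) (m : nat) (hm : (2 <= m)%N)
    (eps : {RV P >-> borel_cV R m}) (heps : has_mean eps 0) :
  (m = 2%N -> (H0 eps (vdir R m) <-> exchangeable eps))
  /\
  (forall (mu : 'cV[R]_m) (Omega : 'M[R]_m),
     posdefmx Omega -> elliptical eps mu Omega -> exchangeable eps ->
     H0 eps (vdir R m) /\
     forall u : 'cV[R]_m, unit_vec u -> u^T *m ones R m = 0 -> H0 eps u).
Proof.
split=> [m2|mu Omega Opos ell ex].
  (* For m = 2 the reflection is the swap, the only permutation matrix besides the identity. *)
  subst m; rewrite /H0 reflmx_vdir2; split=> [sw A|]; last first.
    by apply; exact: perm_mx_is_perm.
  case/perm_mx2 => ->//.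
  by apply: eq_law_fun => t; rewrite /= /mulRV mul1mx.
split=> [|u u1 u0]; apply: (exchangeable_elliptical_H0 _ _ _ _ hm heps Opos ell ex) => //.
- by apply: vdir_unit; exact: ltnW.
- by right; exists (Num.sqrt m%:R)^-1.
- by left.
Qed.
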